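(* Let $K$ be a field, $S=K[x_1,\ldots,x_n]$, and let $d\ge 1$ and $a_1,\ldots,a_n$ be nonnegative integers with $d\geq a_1\geq a_2\geq\cdots\geq a_n$ and $\sum_{i=1}^n a_i\geq d$. Let $I=I_{d;a_1,\ldots,a_n}\subset S$ be the corresponding ideal of Veronese type. Then $\sqrt I$ is squarefree strongly stable.
   Context: The ideal of Veronese type $I_{d;a_1,\ldots,a_n}\subset S$ is the ideal generated by all monomials $x_1^{u_1}\cdots x_n^{u_n}$ with $u_1+\cdots+u_n=d$ and $0\leq u_i\leq a_i$ for all $i$. For a monomial ideal $J$, $G(J)$ is its unique minimal set of monomial generators. A squarefree monomial ideal $J$ is squarefree strongly stable if for all $u\in G(J)$, all $j$ with $x_j\mid u$ and all $l<j$ with $x_l\nmid u$, one has $u\,x_l/x_j\in J$. *)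

(* Defs.v *)
From HB Require Import structures.
From mathcomp Require Import all_boot all_order all_algebra.
From mathcomp Require Import mpoly.

Set Implicit Arguments.
Unset Strict Implicit.
Unset Printing Implicit Defensive.

Import GRing.Theory.
Local Open Scope ring_scope.

(* Ideals are represented as Prop-valued subsets of the ring, compared
   extensionally. *)
Definition ideal_gen (R : comNzRingType) (G : R -> Prop) (f : R) : Prop :=
  exists s : seq (R * R),
    (forall p, p \in s -> G p.2) /\ f = \sum_(p <- s) p.1 * p.2.

Definition radical (R : comNzRingType) (J : R -> Prop) (f : R) : Prop :=
  exists k : nat, (0 < k)%N /\ J (f ^+ k).

Section MonomialIdeals.
Variables (K : fieldType) (n : nat).
Implicit Types (J : {mpoly K[n]} -> Prop) (M G : 'X_{1..n} -> Prop).

(* A set of monomials is given by its set of exponent vectors. *)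
Definition monomial_ideal_gen M : {mpoly K[n]} -> Prop :=
  ideal_gen (fun f : {mpoly K[n]} => exists2 u, M u & f = 'X_[u]).

Definition generates M J : Prop :=
  forall f, J f <-> monomial_ideal_gen M f.

Definition squarefree_monomial (u : 'X_{1..n}) : Prop :=
  forall i : 'I_n, (u i <= 1)%N.

Definition squarefree_monomial_ideal J : Prop :=
  exists M, (forall u, M u -> squarefree_monomial u) /\ generates M J.

(* G is G(J): a set of monomials generating J, minimal under inclusion among
   such sets.  It is unique up to pointwise equivalence, by
   [minimal_generators_unique], so quantifying it existentially below selects
   the set G(J) and asserts that it exists. *)
Definition minimal_generators J G : Prop :=
  generates G J /\
  forall M, (forall u, M u -> G u) -> generates M J -> forall u, G u -> M u.

(* x_j | u is read as (U_(j) <= u)%MM.  Truncated subtraction of exponents is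
   exact here, so (u + U_(l) - U_(j))%MM is the exponent of u x_l / x_j. *)
Definition squarefree_strongly_stable J : Prop :=
  squarefree_monomial_ideal J /\
  exists G, minimal_generators J G /\
    forall (u : 'X_{1..n}) (j l : 'I_n),
      G u -> (U_(j) <= u)%MM -> (l < j)%N -> ~~ (U_(l) <= u)%MM ->
      J 'X_[u + U_(l) - U_(j)].

Definition veronese_ideal (d : nat) (a : 'I_n -> nat) : {mpoly K[n]} -> Prop :=
  monomial_ideal_gen
    (fun u => mdeg u = d /\ forall i : 'I_n, (u i <= a i)%N).

Lemma monomial_ideal_genP M (u : 'X_{1..n}) :
  monomial_ideal_gen M 'X_[u] <-> exists2 v, M v & (v <= u)%MM.
Proof.
split=> [[s [sM e]]|[v Mv le_vu]]; last first.
  exists [:: ('X_[u - v], 'X_[v])]; split.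
    by move=> p; rewrite inE => /eqP->; exists v.
  by rewrite big_seq1 /= -mpolyXD submK.
have : (\sum_(p <- s) p.1 * p.2)@_u != 0 by rewrite -e mcoeffX eqxx oner_eq0.
elim: s sM {e} => [|p s IH] sM; first by rewrite big_nil mcoeff0 eqxx.
rewrite big_cons mcoeffD.
have [/eqP->|nz _] := boolP ((p.1 * p.2)@_u == 0).
  by rewrite add0r; apply: IH => q qs; apply: sM; rewrite inE qs orbT.
have [v Mv pv] := sM p (mem_head _ _).
exists v => //; move: nz; rewrite pv -mcoeff_msupp (perm_mem (msuppMX _ _)).
by case/mapP=> w _ ->; apply: lem_addr.
Qed.

Lemma sub_monomial_ideal_gen M1 M2 :
  (forall u, M1 u -> exists2 v, M2 v & (v <= u)%MM) ->
  forall f, monomial_ideal_gen M1 f -> monomial_ideal_gen M2 f.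
Proof.
move=> M12 f [s [sM ->]]; elim: s sM => [|p s IH] sM.
  by exists [::]; split=> //; rewrite !big_nil.
rewrite big_cons.
have [|t [tM ->]] := IH; first by move=> q qs; apply: sM; rewrite inE qs orbT.
have [u M1u ->] := sM p (mem_head _ _); have [v M2v le_vu] := M12 u M1u.
exists ((p.1 * 'X_[u - v], 'X_[v]) :: t); split.
  by move=> q; rewrite inE => /predU1P[->|/tM //]; exists v.
by rewrite big_cons /= -mulrA -mpolyXD submK.
Qed.

Lemma minimal_generators_unique J G1 G2 :
  minimal_generators J G1 -> minimal_generators J G2 ->
  forall u, G1 u <-> G2 u.
Proof.
suff main H1 H2 u : minimal_generators J H1 -> minimal_generators J H2 ->
    H1 u -> H2 u by move=> h1 h2 u; split; apply: main.
move=> [gen1 min1] [gen2 _] H1u.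
have memX (v : 'X_{1..n}) G : G v -> monomial_ideal_gen G 'X_[v].
  by move=> Gv; apply/monomial_ideal_genP; exists v => //; apply: lepm_refl.
have [v H2v le_vu] : exists2 v, H2 v & (v <= u)%MM.
  by apply/monomial_ideal_genP/gen2/gen1/memX.
have [w H1w le_wv] : exists2 w, H1 w & (w <= v)%MM.
  by apply/monomial_ideal_genP/gen1/gen2/memX.
have [eq_wu|ne_wu] := eqVneq w u.
  suff -> : u = v by [].
  by apply/mnmP=> i; apply/eqP; rewrite eqn_leq -{1}eq_wu (mnm_lepP le_wv)
    (mnm_lepP le_vu).
have [||] // := min1 (fun x => H1 x /\ x <> u) _ _ u H1u.
  by move=> x [].
move=> f; split=> [/gen1|h]; last first.
  apply/gen1; move: h; apply: sub_monomial_ideal_gen => x [H1x _].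
  by exists x => //; apply: lepm_refl.
apply: sub_monomial_ideal_gen => x H1x.
have [->|/eqP ne_xu] := eqVneq x u.
  by exists w; [split=> //; apply/eqP | apply: lepm_trans le_wv le_vu].
by exists x => //; apply: lepm_refl.
Qed.

End MonomialIdeals.

(* Main.v *)
Require Import Defs.
From mathcomp Require Import all_boot all_order all_algebra.
From mathcomp Require Import mpoly.

(** Write [B] for the squarefree monomials [x_F] with [sum_(i in F) a_i >= d].
    If [x_F] is in [B], then [x_F ^+ d] is divisible by some generator of [I],
    since [a_i <= d]; conversely every monomial with a power in [I] is divisible
    by an element of [B].  As the radical of a monomial ideal is again monomial
    (compare leading terms of [f ^+ k] and subtract them off), [B] generates the
    radical of [I].  Replacing [x_j] by [x_l] with [l < j] changes
    [sum_(i in F) a_i] by [a_l - a_j >= 0], hence preserves [B]. *)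

Set Implicit Arguments.
Unset Strict Implicit.
Unset Printing Implicit Defensive.

Import GRing.Theory.
Local Open Scope ring_scope.

Section IdealGen.
Variables (R : comNzRingType) (G : R -> Prop).

Lemma ideal_genD f g :
  ideal_gen G f -> ideal_gen G g -> ideal_gen G (f + g).
Proof.
move=> [s [sG ->]] [t [tG ->]]; exists (s ++ t); split; last by rewrite big_cat.
by move=> p; rewrite mem_cat => /orP[/sG|/tG].
Qed.

Lemma ideal_genMl c f : ideal_gen G f -> ideal_gen G (c * f).
Proof.
move=> [s [sG ->]]; exists [seq (c * p.1, p.2) | p <- s]; split.
  by move=> _ /mapP[p ps ->]; apply: sG ps.
by rewrite big_map mulr_sumr; apply: eq_bigr => p _; rewrite mulrA.
Qed.

Lemma ideal_gen_sum (I : Type) (r : seq I) (P : pred I) (F : I -> R) :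
  (forall i, P i -> ideal_gen G (F i)) -> ideal_gen G (\sum_(i <- r | P i) F i).
Proof.
move=> GF; apply: big_ind => //; last exact: ideal_genD.
by exists [::]; split=> //; rewrite big_nil.
Qed.

Lemma radical_ideal_genMl c f :
  radical (ideal_gen G) f -> radical (ideal_gen G) (c * f).
Proof.
by move=> [k [k0 fk]]; exists k; split=> //; rewrite exprMn; apply: ideal_genMl.
Qed.

Lemma radical_ideal_gen0 : radical (ideal_gen G) 0.
Proof. by exists 1%N; split=> //; exists [::]; split=> //; rewrite big_nil. Qed.

Lemma radical_ideal_genD f g : radical (ideal_gen G) f ->
  radical (ideal_gen G) g -> radical (ideal_gen G) (f + g).
Proof.
move=> [j [j0 fj]] [k [k0 gk]]; exists (j + k)%N; split; first by rewrite addn_gt0 j0.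
rewrite exprDn; apply: ideal_gen_sum => i _; rewrite -mulr_natl; apply: ideal_genMl.
(* Term [i] of the binomial expansion contains [f ^+ (j + k - i) * g ^+ i]: either [g ^+ k] divides
   it, or [i <= k] and [f ^+ j] does. *)
have [le_ki|/ltnW lt_ik] := leqP k i.
  by rewrite -(subnK le_ki) exprD mulrA; apply: ideal_genMl.
by rewrite mulrC -addnBA // [X in f ^+ X]addnC exprD mulrA; apply: ideal_genMl.
Qed.

End IdealGen.

Section MonomialIdeals.
Variables (K : fieldType) (n : nat).
Implicit Types (M : 'X_{1..n} -> Prop) (f : {mpoly K[n]}) (u v m : 'X_{1..n}).

Lemma monomial_ideal_gen_msupp M f :
  monomial_ideal_gen M f <->
  forall m, m \in msupp f -> exists2 v, M v & (v <= m)%MM.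
Proof.
split=> [[s [sM ->]] m|fM].
  elim: s sM => [|p s IH] sM; first by rewrite big_nil msupp0.
  rewrite big_cons => /msuppD_le; rewrite mem_cat => /orP[|]; last first.
    by apply: IH => q qs; apply: sM; rewrite inE qs orbT.
  have [v Mv ->] := sM p (mem_head _ _).
  by rewrite (perm_mem (msuppMX _ _)) => /mapP[w _ ->]; exists v => //; apply: lem_addr.
rewrite /monomial_ideal_gen (mpolyE f) big_seq; apply: ideal_gen_sum => m /fM Mm.
by rewrite -mul_mpolyC; apply/ideal_genMl/monomial_ideal_genP.
Qed.

Lemma radical_monomial_ideal_gen_msupp M f :
  radical (monomial_ideal_gen M) f <->
  forall m, m \in msupp f -> radical (@monomial_ideal_gen K n M) 'X_[m].
Proof.
split=> [|fM]; last first.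
  rewrite (mpolyE f) big_seq; apply: big_ind => [|g h|m /fM mM].
  - exact: radical_ideal_gen0.
  - exact: radical_ideal_genD.
  - by rewrite -mul_mpolyC; apply: radical_ideal_genMl.
(* Induction on the number of terms of [f], peeling off the leading one. *)
have [s] := ubnP (size (msupp f)); elim: s f => // s IH f le_fs rad_f.
have [->|nz_f] := eqVneq f 0; first by rewrite msupp0.
have lead_f := mlead_supp nz_f; set m0 := mlead f in lead_f.
have rad_m0 : radical (@monomial_ideal_gen K n M) 'X_[m0].
  have [k [k0 fk]] := rad_f; exists k; split=> //.
  (* The leading monomial of [f ^+ k] is the [k]-th power of that of [f], and it lies in the support
     of an element of the ideal. *)
  rewrite mpolyXn -mleadX //; apply/monomial_ideal_genP.
  by apply: (proj1 (monomial_ideal_gen_msupp _ _) fk); rewrite mlead_supp ?expf_neq0.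
pose g := f - f@_m0 *: 'X_[m0].
have supp_g : perm_eq (msupp g) (rem m0 (msupp f)) by apply: msupp_rem.
have rad_g : radical (monomial_ideal_gen M) g.
  apply: radical_ideal_genD => //; rewrite -mulN1r; apply: radical_ideal_genMl.
  by rewrite -mul_mpolyC; apply: radical_ideal_genMl.
move=> m mf; have [->//|ne_m] := eqVneq m m0; apply: (IH g) => //.
  by rewrite (perm_size supp_g) size_rem // prednK // -has_predT; apply/hasP; exists m0.
by rewrite (perm_mem supp_g) mem_rem_uniq ?msupp_uniq // inE ne_m.
Qed.

(** The candidate for G(J). Taking [B] boolean makes the search for a smaller element of [B]
    decidable. *)
Definition minimal_monomials (B : pred 'X_{1..n}) u : Prop :=
  B u /\ forall v, B v -> (v <= u)%MM -> v = u.

Lemma mdeg_ltn_lepm u v : (v <= u)%MM -> v != u -> (mdeg v < mdeg u)%N.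
Proof.
move=> le_vu ne_vu; rewrite -(submK le_vu) mdegD -[ltnLHS]add0n ltn_add2r lt0n mdeg_eq0.
by apply: contra ne_vu => /eqP uv0; rewrite -(submK le_vu) uv0 add0m.
Qed.

Lemma minimal_monomials_below (B : pred 'X_{1..n}) u :
  B u -> exists2 v, minimal_monomials B v & (v <= u)%MM.
Proof.
have [s] := ubnP (mdeg u); elim: s u => // s IH u le_us Bu.
(* Proper divisors of [u] have smaller degree, so they all lie in the finite type of monomials of
   degree below [mdeg u]. *)
have [/existsP[v /andP[Bv le_vu]]|/existsPn min_u] :=
  boolP [exists v : 'X_{1..n < mdeg u}, B v && (v <= u)%MM].
  have [w min_w le_wv] := IH v (leq_trans (bmdeg v) le_us) Bv.
  by exists w => //; apply: lepm_trans le_wv le_vu.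
exists u; last exact: lepm_refl.
split=> // v Bv le_vu; apply/eqP/negP => /negP ne_vu.
by have /negP[] := min_u (BMultinom (mdeg_ltn_lepm le_vu ne_vu)); rewrite /= Bv.
Qed.

(** A generating subset must contain a divisor of each minimal [u]; as that divisor is in [B], it
    equals [u]. *)
Lemma minimal_monomials_generators (B : pred 'X_{1..n}) (J : {mpoly K[n]} -> Prop) :
  generates B J -> minimal_generators J (minimal_monomials B).
Proof.
move=> genB; split=> [f|M subM genM u [Bu min_u]].
  rewrite genB; split; apply: sub_monomial_ideal_gen => u.
    exact: minimal_monomials_below.
  by move=> [Bu _]; exists u => //; apply: lepm_refl.
have /genM/monomial_ideal_genP[v Mv le_vu] : J 'X_[u].
  by apply/genB/monomial_ideal_genP; exists u => //; apply: lepm_refl.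
by have [Bv _] := subM v Mv; rewrite -(min_u v Bv le_vu).
Qed.

End MonomialIdeals.

(** Serves to cut a monomial of large degree down to the exact degree [d] of the Veronese
    generators; [u] grows by one variable at a time. *)
Lemma mdeg_truncate n (b : 'X_{1..n}) d :
  (d <= mdeg b)%N -> exists2 u : 'X_{1..n}, mdeg u = d & (u <= b)%MM.
Proof.
elim: d => [|d IH] le_db; first by exists 0%MM; [exact: mdeg0 | by apply/mnm_lepP => i; rewrite mnm0E].
have [u deg_u le_ub] := IH (ltnW le_db).
have [i lt_ui] : exists i, (u i < b i)%N.
  apply/existsP; apply: contraTT le_db => /existsPn ge_ub.
  rewrite -leqNgt -deg_u !mdegE; apply: leq_sum => i _.
  by rewrite leqNgt; apply: ge_ub.
exists (u + U_(i))%MM; first by rewrite mdegD mdeg1 deg_u addn1.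
apply/mnm_lepP => k; rewrite mnmDE mnm1E.
by have [<-|_] := eqVneq i k; rewrite ?addn1 // addn0 (mnm_lepP le_ub).
Qed.

Section Veronese.
Variables (K : fieldType) (n d : nat) (a : 'I_n -> nat).
Implicit Types (u v m : 'X_{1..n}).

(** The set [B] of the overview: for a 0/1 vector [u], the weighted sum runs over the support of
    [u]. *)
Definition veronese_support u : bool :=
  [forall i, (u i <= 1)%N] && (d <= \sum_i a i * u i)%N.

Lemma radical_veronese_monomial m :
  (0 < d)%N -> (forall i, (a i <= d)%N) ->
  radical (@veronese_ideal K n d a) 'X_[m] <->
  exists2 v, veronese_support v & (v <= m)%MM.
Proof.
move=> d0 le_ad; split=> [[k [k0]]|[v /andP[/forallP sqf_v le_dv] le_vm]].
  rewrite mpolyXn => /monomial_ideal_genP[u [deg_u le_ua] le_um].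
  (* The witness is the product of the variables dividing [m]. A generator [u] dividing the power of
     [m] involves only these variables, so its degree [d] is at most the sum of their [a i]. *)
  exists [multinom (0 < m i)%N : nat | i < n]; last first.
    by apply/mnm_lepP => i; rewrite mnmE; case: (m i).
  apply/andP; split; first by apply/forallP => i; rewrite mnmE leq_b1.
  rewrite -[leqLHS]deg_u mdegE; apply: leq_sum => i _; rewrite mnmE.
  have := mnm_lepP le_um i; rewrite mulmnE.
  by case: (m i) => [|p] /= le_ui; rewrite ?muln0 ?muln1 // -(mul0n k).
exists d; split=> //; rewrite mpolyXn; apply/monomial_ideal_genP.
(* This monomial has degree at least [d], its exponents are at most [a i] because [v] is squarefree,
   and it divides the [d]-th power of [m] because [a i <= d]. *)
have [|u deg_u le_u] := @mdeg_truncate n [multinom (a i * v i)%N | i < n] d.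
  by rewrite mdegE; under eq_bigr do rewrite mnmE.
exists u.
  split=> // i; apply: leq_trans (mnm_lepP le_u i) _.
  by rewrite mnmE -[leqRHS]muln1 leq_mul2l sqf_v orbT.
apply/mnm_lepP => i; apply: leq_trans (mnm_lepP le_u i) _.
by rewrite mnmE mulmnE mulnC leq_mul // (mnm_lepP le_vm).
Qed.

Lemma veronese_support_generates :
  (0 < d)%N -> (forall i, (a i <= d)%N) ->
  generates veronese_support (radical (@veronese_ideal K n d a)).
Proof.
move=> d0 le_ad f; rewrite monomial_ideal_gen_msupp radical_monomial_ideal_gen_msupp.
by split=> fB m /fB /(radical_veronese_monomial _ d0 le_ad).
Qed.

Lemma veronese_support_exchange u (j l : 'I_n) :
  (a j <= a l)%N -> veronese_support u -> (U_(j) <= u)%MM -> ~~ (U_(l) <= u)%MM ->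
  veronese_support (u + U_(l) - U_(j))%MM.
Proof.
move=> le_a /andP[/forallP sqf_u le_du] le_ju.
rewrite !lep1mP negbK in le_ju * => /eqP ul0.
have ne_jl : j != l by apply: contraNneq le_ju => ->; rewrite ul0.
have uj1 : u j = 1%N by apply/eqP; rewrite eqn_leq sqf_u lt0n.
have wE i : (u + U_(l) - U_(j))%MM i =
    (if i == j then 0 else if i == l then 1 else u i)%N.
  rewrite mnmBE mnmDE !mnm1E [j == i]eq_sym [l == i]eq_sym.
  have [->|ne_ij] := eqVneq i j; first by rewrite (negPf ne_jl) uj1.
  by have [->|ne_il] := eqVneq i l; rewrite ?ul0 ?addn0 subn0.
apply/andP; split.
  by apply/forallP => i; rewrite wE; case: ifP => // _; case: ifP.
apply: leq_trans le_du _.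
have ne_lj : l != j by rewrite eq_sym.
(* With the terms at [j] and [l] isolated, the exchange trades [a j] for [a l] and leaves the rest
   of the sum unchanged. *)
rewrite (bigD1 j) // (bigD1 l) //= [leqRHS](bigD1 j) // [in leqRHS](bigD1 l) //=.
rewrite !wE !eqxx (negPf ne_lj) ul0 uj1 !muln0 !muln1 !add0n leq_add //.
by apply: leq_sum => i /andP[ne_ij ne_il]; rewrite wE (negPf ne_ij) (negPf ne_il).
Qed.

End Veronese.

Theorem lemma2p1 (K : fieldType) (n d : nat) (a : 'I_n -> nat)
    (hd : (1 <= d)%N)
    (had : forall i : 'I_n, (a i <= d)%N)
    (ha : forall i j : 'I_n, (i <= j)%N -> (a j <= a i)%N)
    (hsum : (d <= \sum_(i < n) a i)%N) :
  squarefree_strongly_stable (radical (@veronese_ideal K n d a)).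
Proof.
have genB := @veronese_support_generates K n d a hd had.
split.
  by exists (veronese_support d a); split=> // u /andP[/forallP].
exists (minimal_monomials (veronese_support d a)); split.
  exact: minimal_monomials_generators.
move=> u j l [Bu _] le_ju lt_lj nle_lu.
(* The exchanged monomial is itself in [B], so it serves as its own divisor. *)
apply/radical_veronese_monomial => //.
exists (u + U_(l) - U_(j))%MM; last exact: lepm_refl.
by apply: veronese_support_exchange => //; apply/ha/ltnW.
Qed.
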